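(* Let $p$ be a prime, let $n,m\ge 1$ be integers, and let $\lambda\in(\mathbb{Z}/p^m\mathbb{Z})^\times$ satisfy $\lambda^{p^n}\equiv 1 \bmod p^m$. Let $$G=\mathbb{Z}/p^m\mathbb{Z}\rtimes_\lambda \mathbb{Z}/p^n\mathbb{Z}$$ be the semidirect product with action $\mathbb{Z}/p^n\mathbb{Z}\to \mathrm{Aut}(\mathbb{Z}/p^m\mathbb{Z})=(\mathbb{Z}/p^m\mathbb{Z})^\times$ sending $1\mapsto\lambda$. Then $G$ admits an unmixed Beauville structure if and only if $p\ge 5$ and $n=m$. Moreover, all Beauville structures on such a group $G$ are balanced of constant signature $p^n$, i.e. all six elements of the structure have order $p^n$.
   Context: An (unmixed) Beauville structure on a finite group $G$ consists of an ordered pair of triples $(x,y,z)$ and $(a,b,c)$ of elements of $G$ such that (1) $xyz=1=abc$; (2) $G$ is generated by $\{x,y,z\}$ and also by $\{a,b,c\}$; (3) no non-trivial power (i.e. power different from $1$) of an element of $\{x,y,z\}$ is conjugate in $G$ to a power of an element of $\{a,b,c\}$. The signature of the Beauville structure is the tuple of orders of $x,y,z,a,b,c$, and the Beauville structure is balanced if these orders are all equal. *)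

(* Defs.v *)
From mathcomp Require Import all_boot all_order all_algebra all_fingroup.

Set Implicit Arguments.
Unset Strict Implicit.
Unset Printing Implicit Defensive.

Import GRing.Theory GroupScope.

Section Beauville.

Variables (gT : finGroupType) (G : {group gT}).

(* Membership of the six elements in G follows from the generation clauses.
   As G is finite, powers with natural exponents are all the powers. *)
Definition beauville_structure (x y z a b c : gT) : Prop :=
  [/\ x * y * z = 1 /\ a * b * c = 1,
      <<[set x; y; z]>> = G,
      <<[set a; b; c]>> = G
    & forall u v (i j : nat),
        u \in [set x; y; z] -> v \in [set a; b; c] ->
        u ^+ i != 1 -> v ^+ j \notin (u ^+ i) ^: G].

Definition admits_beauville_structure : Prop :=
  exists x y z a b c : gT, beauville_structure x y z a b c.

Definition signature (x y z a b c : gT) : seq nat :=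
  [:: #[x]; #[y]; #[z]; #[a]; #[b]; #[c]].

End Beauville.

Section CyclicSemidirectProduct.

(* The positivity of n matters: 'Z_1 denotes Z/2. *)
Variables (p n m : nat) (p_pr : prime p) (n_gt0 : (0 < n)%N).
Variables (lam : {unit 'Z_(p ^ m)}) (lamP : lam ^+ (p ^ n) = 1).

(* MathComp's semidirect products are built from right actions, which become
   the conjugations x ^ a = a^-1 * x * a. The inverse below makes the residue
   class a act through left conjugation a * x * a^-1 as multiplication by
   lam ^+ a; see csdprod_conj. *)
Definition mul_lam (x : 'Z_(p ^ m)) (a : 'Z_(p ^ n)) : 'Z_(p ^ m) :=
  (FinRing.uval (lam ^- a) * x)%R.

Let expZ : (Zp_trunc (p ^ n)).+2 = (p ^ n)%N.
Proof.
by apply: Zp_cast; rewrite -(expn0 p) ltn_exp2l ?prime_gt1.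
Qed.

Lemma lam_exp_mod k : lam ^+ (k %% (Zp_trunc (p ^ n)).+2) = lam ^+ k.
Proof. by rewrite expZ expg_mod. Qed.

Lemma mul_lam_is_action : is_action [set: 'Z_(p ^ n)] mul_lam.
Proof.
apply: is_total_action => [x | x a b]; rewrite /mul_lam.
  by rewrite expg0 invg1 /= mul1r.
rewrite mulrA -FinRing.val_unitM -invMg -expgD /=.
by rewrite lam_exp_mod.
Qed.

Canonical mul_lam_action := Action mul_lam_is_action.

Lemma mul_lam_is_groupAction :
  is_groupAction [set: 'Z_(p ^ m)] mul_lam_action.
Proof.
move=> a Da; rewrite inE; apply/andP; split.
  by apply/subsetP=> x _; rewrite inE.
apply/morphicP=> x y _ _; rewrite !actpermE /= /mul_lam.
exact: mulrDr.
Qed.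

Definition mul_lam_groupAction := GroupAction mul_lam_is_groupAction.

Definition csdprod : finGroupType := sdprod_by mul_lam_groupAction.

Lemma csdprod_conj (x : 'Z_(p ^ m)) (a : 'Z_(p ^ n)) :
  let inN := sdpair1 mul_lam_groupAction in
  let inQ := sdpair2 mul_lam_groupAction in
  inQ a * inN x * (inQ a)^-1 = inN (FinRing.uval (lam ^+ a) * x)%R.
Proof.
move=> inN inQ; apply: (canLR (mulgK _)); apply: (mulgI (inQ a)^-1).
set y := (_ * x)%R.
have := @sdpair_act _ _ _ _ mul_lam_groupAction y (a : 'Z_(p ^ n)).
rewrite !inE => /(_ isT isT).
rewrite /conjg -/inN -/inQ => <-; rewrite mulKg /= /mul_lam /y.
by rewrite mulrA -FinRing.val_unitM mulVg mul1r.
Qed.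

End CyclicSemidirectProduct.

(* Main.v *)
(* Let s and t generate the two factors and write the elements of G as
   t^j s^i; then s^t = s^r with r = 1 modulo p, so that the residues (i, j)
   modulo p define a morphism of G onto F_p^2. Both triples of a Beauville
   structure span F_p^2, and each sums to 0 there. By lifting the exponent, the
   p^k-th power of t^j s^i is t^(p^k j) s^(p^k i) for k + 1 >= m, provided that
   p is odd or that r^j = 1 modulo 4. Hence for p odd:
   - if n <> m, the cyclic groups generated by the elements of maximal order
     share their subgroup of order p, and both triples contain such an element;
   - if n = m, the p^(n-1)-th power map factors through an injection of F_p^2
     onto a central subgroup, so the triples must meet disjoint sets of three
     lines among the p + 1 lines of F_p^2, which is possible exactly for p >= 5.
   For p = 2 each triple contains elements with residues (1, 0) and (0, 1), and
   the former (if n < m) or the latter (if m <= n) share a power. *)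
Require Import Defs.
From mathcomp Require Import all_boot all_order all_algebra all_fingroup.
From mathcomp Require Import cyclic ring zify.
Set Implicit Arguments.
Unset Strict Implicit.
Unset Printing Implicit Defensive.
Import GRing.Theory GroupScope.

(** * Geometric sums modulo prime powers *)

Definition geom (q k : nat) : nat := \sum_(l < k) (q ^ l)%N.

Lemma geom0 q : geom q 0 = 0%N.
Proof. exact: big_ord0. Qed.

Lemma geomS q k : geom q k.+1 = (geom q k * q + 1)%N.
Proof.
rewrite /geom big_ord_recl expn0 addnC big_distrl /=.
by congr addn; apply: eq_bigr => i _; rewrite -expnSr.
Qed.

(** Exponents below [a * b] split into [b] blocks of length [a]; this reduces sums of length [p ^ k]
    to sums of length [p]. *)
Lemma geom_mul q a b : geom q (a * b) = (geom q a * geom (q ^ a) b)%N.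
Proof.
elim: b => [|b IH]; first by rewrite muln0 !geom0 muln0.
rewrite /geom mulnS big_split_ord /= !(big_ord_recl b) /= expn0.
rewrite mulnDr muln1; congr addn.
under eq_bigr => i _ do rewrite expnD.
rewrite -big_distrr /= -/(geom q (a * b)) IH mulnCA; congr muln.
rewrite /geom big_distrr /=; apply: eq_bigr => i _.
by rewrite -expnS.
Qed.

Lemma exp_mod1 d q k : q = 1 %[mod d] -> q ^ k = 1 %[mod d].
Proof. by move=> q1; rewrite -modnXm q1 modnXm exp1n. Qed.

Lemma dvdn_geom_prime p q : q = 1 %[mod p] -> p %| geom q p.
Proof.
move=> q1; rewrite /dvdn /geom -modn_summ.
under eq_bigr => i _ do rewrite (exp_mod1 _ q1).
by rewrite modn_summ sum_nat_const card_ord muln1 modnn.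
Qed.

Lemma dvdn_geom p q k : q = 1 %[mod p] -> p ^ k %| geom q (p ^ k).
Proof.
move=> q1; elim: k => [|k IH]; first by rewrite expn0.
by rewrite expnSr geom_mul dvdn_mul // dvdn_geom_prime //; apply: exp_mod1.
Qed.

(* For p = 2 the case q = 3 shows that a condition modulo 4 is needed. *)
Lemma geom_prime_mod p q : prime p -> odd p || (q == 1 %[mod 4]) ->
  q = 1 %[mod p] -> geom q p = p %[mod p ^ 2].
Proof.
move=> p_pr odd_p q1.
case: (even_prime p_pr) odd_p => [->|odd_p _].
  move=> /= /eqP q14; rewrite /geom !big_ord_recl big_ord0 expn0 expn1 addn0.
  by rewrite -modnDmr q14.
have p_gt1 := prime_gt1 p_pr.
have [e qE] : exists e, (q = e * p + 1)%N.
  by exists (q %/ p); rewrite [LHS](divn_eq q p) q1 modn_small.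
(* As [p] divides [q - 1], the binomial expansion stops at the linear term. *)
have qX l : q ^ l = 1 + l * (e * p) %[mod p ^ 2].
  elim: l => [|l IH] //; rewrite expnSr -modnMml IH modnMml qE.
  have -> : ((1 + l * (e * p)) * (e * p + 1) =
            l * e * e * (p ^ 2) + (1 + l.+1 * (e * p)))%N by ring.
  by rewrite modnMDl.
rewrite /geom -modn_summ; under eq_bigr => i _ do rewrite qX.
rewrite modn_summ big_split /= sum_nat_const card_ord muln1 -big_distrl /=.
rewrite -(big_mkord xpredT id) bin2_sum.
(* For odd [p] the prime [p] divides ['C(p, 2)], so the linear terms add up to 0 modulo [p ^ 2]. *)
have /dvdnP[f ->] : p ^ 2 %| 'C(p, 2) * (e * p).
  by rewrite mulnA -mulnn dvdn_mul ?dvdn_mulr // prime_dvd_bin // odd_prime_gt2.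
by rewrite addnC modnMDl.
Qed.

(** Lifting the exponent: the sum is a product of [k] sums of length [p], each equal to [p] times a
    number congruent to 1 modulo [p]. *)
Lemma geom_pX p q k : prime p -> odd p || (q == 1 %[mod 4]) ->
    q = 1 %[mod p] ->
  exists2 w, geom q (p ^ k) = (p ^ k * w)%N & w = 1 %[mod p].
Proof.
move=> p_pr odd_p q1; elim: k => [|k [w IH w1]].
  by exists 1%N; rewrite // expn0 geomS geom0 muln1.
have q1' := exp_mod1 (p ^ k) q1.
have odd_p' : odd p || (q ^ (p ^ k) == 1 %[mod 4]).
  by case/orP: odd_p => [->//|/eqP/exp_mod1->]; rewrite orbT.
have /dvdnP[v vE] := dvdn_geom_prime q1'.
have := geom_prime_mod p_pr odd_p' q1'.
rewrite vE -{3}[p]mul1n -mulnn -!muln_modl ?prime_gt0 //.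
move/eqP; rewrite eqn_pmul2r ?prime_gt0 // => /eqP v1.
exists (w * v)%N; first by rewrite expnSr geom_mul IH vE; ring.
by rewrite -modnMm w1 v1 modnMm.
Qed.

Lemma pX_mod p k d a b : d <= k.+1 -> a = b %[mod p] ->
  p ^ k * a = p ^ k * b %[mod p ^ d].
Proof.
move=> le_dk ab.
have dv : p ^ d %| p ^ k.+1 by rewrite dvdn_exp2l.
rewrite -(modn_dvdm _ dv) -(modn_dvdm (p ^ k * b) dv) expnSr.
by rewrite -!muln_modr ab.
Qed.

(** * Residues in prime fields *)

Lemma Fp_natE p a b : prime p ->
  ((a%:R : 'F_p)%R == b%:R)%R = (a == b %[mod p]).
Proof.
by move=> p_pr; rewrite -(inj_eq val_inj) /= !val_Zp_nat pdiv_id ?prime_gt1.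
Qed.

Lemma Fp_nat0 p a : prime p -> ((a%:R : 'F_p)%R == 0%R) = (p %| a).
Proof. by move=> p_pr; rewrite (Fp_natE a 0) // mod0n. Qed.

Lemma F2_neq0 (a : 'F_2) : (a != 0 -> a = 1)%R.
Proof. by case: a => [[|[|k]] //] i _; apply: val_inj. Qed.

Lemma F3_addr_neq0 (a b : 'F_3) : (a != 0 -> b != 0 -> a + b != 0 -> a = b)%R.
Proof.
by case: a b => [[|[|[|k]]] //] i [[|[|[|l]]] //] j _ _ // _; apply: val_inj.
Qed.

(** * Exponent coordinates in a split metacyclic group *)

Section Metacyclic.

Variables (gT : finGroupType) (p n m r : nat) (s t : gT) (X Y : gT -> nat).
Hypotheses (p_pr : prime p) (n_gt0 : 0 < n) (m_gt0 : 0 < m).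
Hypotheses (os : #[s] = (p ^ m)%N) (ot : #[t] = (p ^ n)%N).
Hypotheses (conj_st : s ^ t = s ^+ r) (tist : <[s]> :&: <[t]> = 1).
Hypothesis XY : forall g, g = t ^+ Y g * s ^+ X g.

Lemma eq_expg_s i j : (s ^+ i == s ^+ j) = (i == j %[mod p ^ m]).
Proof. by rewrite eq_expg_mod_order os. Qed.

Lemma eq_expg_t i j : (t ^+ i == t ^+ j) = (i == j %[mod p ^ n]).
Proof. by rewrite eq_expg_mod_order ot. Qed.

(** Once the powers of [t] are separated from those of [s], both sides lie in the trivial
    intersection. *)
Lemma coords_uniq j i j' i' : t ^+ j * s ^+ i = t ^+ j' * s ^+ i' ->
  j = j' %[mod p ^ n] /\ i = i' %[mod p ^ m].
Proof.
move=> E; have E' : (t ^+ j')^-1 * t ^+ j = s ^+ i' * (s ^+ i)^-1.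
  by apply: (mulIg (s ^+ i)); rewrite mulgKV -mulgA E mulKg.
have : s ^+ i' * (s ^+ i)^-1 \in <[s]> :&: <[t]>.
  by rewrite inE -{2}E' !groupM ?groupV ?mem_cycle.
rewrite tist => /set1P Es; rewrite Es in E'; split; apply/eqP.
  by rewrite -eq_expg_t -(mulKVg (t ^+ j') (t ^+ j)) E' mulg1.
by rewrite eq_sym -eq_expg_s -(mulgKV (s ^+ i) (s ^+ i')) Es mul1g.
Qed.

Lemma conj_sX i j : (s ^+ i) ^ (t ^+ j) = s ^+ (i * r ^ j).
Proof.
elim: j => [|j IH]; first by rewrite conjg1 muln1.
by rewrite expgSr conjgM IH conjXg conj_st -expgM expnS; congr (s ^+ _); ring.
Qed.

Lemma mul_coords j i j' i' :
  t ^+ j * s ^+ i * (t ^+ j' * s ^+ i') = t ^+ (j + j') * s ^+ (i * r ^ j' + i').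
Proof. by rewrite !expgD -conj_sX /conjg !mulgA mulgK. Qed.

(** Moving [s ^+ i] past one [t ^+ j] multiplies its exponent by [r ^ j], so the exponents of [s]
    add up to a geometric sum. *)
Lemma expg_coords j i k :
  (t ^+ j * s ^+ i) ^+ k = t ^+ (j * k) * s ^+ (i * geom (r ^ j) k).
Proof.
elim: k => [|k IH]; first by rewrite geom0 !muln0 mulg1.
rewrite expgSr IH mul_coords geomS mulnS addnC.
by congr (_ * s ^+ _); ring.
Qed.

(** Since [t ^+ (p ^ n) = 1] centralizes [s], the power [r ^ (p ^ n)] is 1 modulo [p ^ m]; by Fermat
    it is also [r] modulo [p]. *)
Lemma r_mod1 : r = 1 %[mod p].
Proof.
have : s ^+ (r ^ (p ^ n)) == s ^+ 1.
  by rewrite -[(r ^ _)%N]mul1n -conj_sX -ot expg_order conjg1.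
rewrite eq_expg_s => /eqP E.
have fermat k : (r ^ (p ^ k))%N = r %[mod p].
  elim: k => [|k IH]; first by rewrite expn0 expn1.
  by rewrite expnSr expnM fermat_little.
have dv : p %| (p ^ m)%N by rewrite dvdn_exp.
by rewrite -(fermat n) -(modn_dvdm _ dv) E modn_dvdm.
Qed.

(* The exponents of s and t modulo p; as r = 1 modulo p they are additive, so
   that (phi, psi) is a morphism onto F_p^2. *)
Definition phi g : 'F_p := ((X g)%:R)%R.
Definition psi g : 'F_p := ((Y g)%:R)%R.

Lemma Fp_natr_pX k a b : 0 < k -> a = b %[mod p ^ k] ->
  (a%:R = b%:R :> 'F_p)%R.
Proof.
move=> k_gt0 E; apply/eqP; rewrite Fp_natE //.
have dv : p %| (p ^ k)%N by rewrite dvdn_exp.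
by rewrite -(modn_dvdm a dv) E modn_dvdm.
Qed.

Lemma phi_coords j i : phi (t ^+ j * s ^+ i) = (i%:R)%R.
Proof. have [_ /esym] := coords_uniq (XY (t ^+ j * s ^+ i)).
exact: Fp_natr_pX. Qed.

Lemma psi_coords j i : psi (t ^+ j * s ^+ i) = (j%:R)%R.
Proof. have [/esym E _] := coords_uniq (XY (t ^+ j * s ^+ i)); move: E.
exact: Fp_natr_pX. Qed.

Lemma phiM g h : phi (g * h) = (phi g + phi h)%R.
Proof.
rewrite [g]XY [h]XY mul_coords !phi_coords natrD natrM natrX.
have /eqP -> : (r%:R == 1%:R :> 'F_p)%R by rewrite Fp_natE // r_mod1.
by rewrite expr1n mulr1.
Qed.

Lemma psiM g h : psi (g * h) = (psi g + psi h)%R.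
Proof. by rewrite [g]XY [h]XY mul_coords !psi_coords natrD. Qed.

Lemma phi1 : phi 1 = 0%R.
Proof. by rewrite -[1]mulg1 -{1}(expg0 t) -(expg0 s) phi_coords. Qed.

Lemma psi1 : psi 1 = 0%R.
Proof. by rewrite -[1]mulg1 -{1}(expg0 t) -(expg0 s) psi_coords. Qed.

Lemma coords_s : phi s = 1%R /\ psi s = 0%R.
Proof. by rewrite -[s]mul1g -(expg0 t) -(expg1 s) phi_coords psi_coords. Qed.

Lemma coords_t : phi t = 0%R /\ psi t = 1%R.
Proof. by rewrite -[t]mulg1 -(expg0 s) -(expg1 t) phi_coords psi_coords. Qed.

(** * Powers whose exponent is a multiple of [p ^ k] *)

Lemma expt_p_eq1 k : (t ^+ (p ^ n.-1 * k) == 1) = (p %| k).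
Proof.
rewrite -order_dvdn ot -{1}(prednK n_gt0) expnSr dvdn_pmul2l //.
by rewrite expn_gt0 prime_gt0.
Qed.

Lemma exps_p_eq1 k : (s ^+ (p ^ m.-1 * k) == 1) = (p %| k).
Proof.
rewrite -order_dvdn os -{1}(prednK m_gt0) expnSr dvdn_pmul2l //.
by rewrite expn_gt0 prime_gt0.
Qed.

Lemma expt_pX k a b : n <= k.+1 -> (a%:R = b%:R :> 'F_p)%R ->
  t ^+ (p ^ k * a) = t ^+ (p ^ k * b).
Proof.
move=> le_nk /eqP; rewrite Fp_natE // => /eqP ab.
by apply/eqP; rewrite eq_expg_t; apply/eqP/pX_mod.
Qed.

Lemma exps_pX k a b : m <= k.+1 -> (a%:R = b%:R :> 'F_p)%R ->
  s ^+ (p ^ k * a) = s ^+ (p ^ k * b).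
Proof.
move=> le_mk /eqP; rewrite Fp_natE // => /eqP ab.
by apply/eqP; rewrite eq_expg_s; apply/eqP/pX_mod.
Qed.

(** The geometric sum is divisible by [p ^ n.-1], which kills the part in [<[s]>] if [m < n]; if
    [m = n], the condition [phi g = 0] supplies the missing factor [p]. This covers [p = 2]. *)
Lemma expg_pX_t g : m <= n -> (m < n) || (phi g == 0%R) ->
  g ^+ (p ^ n.-1) = t ^+ (p ^ n.-1 * Y g).
Proof.
move=> le_mn mn; rewrite {1}[g]XY expg_coords mulnC -[RHS]mulg1; congr (_ * _).
apply/eqP; rewrite -order_dvdn os.
have dv := dvdn_geom n.-1 (exp_mod1 (Y g) r_mod1).
case/orP: mn => [lt_mn | ].
  by rewrite dvdn_mull // (dvdn_trans _ dv) // dvdn_exp2l // -ltnS prednK.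
rewrite Fp_nat0 // => dvX; apply: (@dvdn_trans (p ^ n)); first exact: dvdn_exp2l.
by rewrite -(prednK n_gt0) expnS dvdn_mul.
Qed.

Lemma expg_pX k g : m <= k.+1 -> odd p || ((r ^ Y g)%N == 1 %[mod 4]) ->
  g ^+ (p ^ k) = t ^+ (p ^ k * Y g) * s ^+ (p ^ k * X g).
Proof.
move=> le_mk odd_p; rewrite {1}[g]XY expg_coords mulnC; congr (_ * _).
have [w -> w1] := geom_pX k p_pr odd_p (exp_mod1 (Y g) r_mod1).
rewrite mulnCA; apply: exps_pX => //; rewrite natrM.
have /eqP -> : (w%:R == 1%:R :> 'F_p)%R by rewrite Fp_natE // w1.
by rewrite mulr1.
Qed.

(** * Linear algebra of generating triples over ['F_p] *)

Local Open Scope ring_scope.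

Definition coord_det g h := phi g * psi h - phi h * psi g.

(** The zeros of a linear form on F_p^2 pull back to a subgroup, here the whole group; its values at
    [s] and [t] are the coefficients. *)
Lemma coords_linear_gen al be (A : {set gT}) : <<A>>%g = [set: gT] ->
  {in A, forall g, al * phi g + be * psi g = 0} -> al = 0 /\ be = 0.
Proof.
move=> genA A0; pose K := [set g | al * phi g + be * psi g == 0].
have gK : group_set K.
  apply/group_setP; split=> [|g h]; first by rewrite inE phi1 psi1 !mulr0 addr0.
  rewrite !inE phiM psiM => /eqP g0 /eqP h0.
  by rewrite !mulrDr addrACA g0 h0 addr0.
have KT g : g \in Group gK.
  have : g \in [set: gT] by rewrite inE.
  rewrite -genA; apply: subsetP; rewrite gen_subG.
  by apply/subsetP => h Ah; rewrite inE A0.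
have [[ps qs] [pt qt]] := (coords_s, coords_t).
move: (KT s) (KT t); rewrite !inE ps qs pt qt !mulr0 !mulr1 addr0 add0r.
by move=> /eqP-> /eqP->.
Qed.

Section Triple.

Variables x y z : gT.
Hypotheses (xyz1 : (x * y * z = 1)%g) (gen : <<[set x; y; z]>>%g = [set: gT]).

Lemma phi_triple : phi z = - (phi x + phi y).
Proof.
have /esym/eqP := phiM (x * y) z; rewrite xyz1 phi1 phiM addrC addr_eq0.
by move/eqP.
Qed.

Lemma psi_triple : psi z = - (psi x + psi y).
Proof.
have /esym/eqP := psiM (x * y) z; rewrite xyz1 psi1 psiM addrC addr_eq0.
by move/eqP.
Qed.

Lemma linear_triple al be :
  al * phi x + be * psi x = 0 -> al * phi y + be * psi y = 0 ->
  al = 0 /\ be = 0.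
Proof.
move=> x0 y0; apply: (coords_linear_gen gen) => g.
rewrite !inE -orbA => /or3P[] /eqP -> //.
rewrite phi_triple psi_triple.
have -> : al * - (phi x + phi y) + be * - (psi x + psi y) =
  - (al * phi x + be * psi x) - (al * phi y + be * psi y) by ring.
by rewrite x0 y0 oppr0 addr0.
Qed.

(** Otherwise the form with coefficients [psi x] and [- phi x] kills the triple, so [x] maps to 0,
    and likewise [y]; then every form kills the triple. *)
Lemma det_triple : coord_det x y != 0.
Proof.
apply/eqP => d0.
have [qx px] : psi x = 0 /\ - phi x = 0.
  by apply: linear_triple; [ring | rewrite -oppr0 -d0 /coord_det; ring].
move/eqP: px; rewrite oppr_eq0 => /eqP px.
have [qy py] : psi y = 0 /\ - phi y = 0.
  by apply: linear_triple; [rewrite px qx; ring | ring].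
move/eqP: py; rewrite oppr_eq0 => /eqP py.
have [/eqP] : 1 = 0 :> 'F_p /\ 1 = 0 :> 'F_p.
  by apply: linear_triple; rewrite ?px ?qx ?py ?qy; ring.
by rewrite oner_eq0.
Qed.

Lemma triple_neq0 g : g \in [set x; y; z] -> (phi g != 0) || (psi g != 0).
Proof.
move=> Tg; rewrite -negb_and; apply: contra det_triple => /andP[/eqP pg /eqP qg].
rewrite /coord_det; move: Tg; rewrite !inE -orbA => /or3P[] /eqP E; subst g.
- by rewrite pg qg; apply/eqP; ring.
- by rewrite pg qg; apply/eqP; ring.
have -> : phi x = - phi y.
  by apply/eqP; rewrite -addr_eq0 -oppr_eq0 -phi_triple pg.
have -> : psi x = - psi y.
  by apply/eqP; rewrite -addr_eq0 -oppr_eq0 -psi_triple qg.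
by apply/eqP; ring.
Qed.

Lemma triple_phi_neq0 : exists2 g, g \in [set x; y; z] & phi g != 0.
Proof.
have := det_triple; rewrite /coord_det.
have [px|px _] := eqVneq (phi x) 0; last by exists x; rewrite // !inE eqxx.
have [py|py _] := eqVneq (phi y) 0; last by exists y; rewrite // !inE eqxx ?orbT.
by rewrite px py !mul0r subrr eqxx.
Qed.

Lemma triple_psi_neq0 : exists2 g, g \in [set x; y; z] & psi g != 0.
Proof.
have := det_triple; rewrite /coord_det.
have [px|px _] := eqVneq (psi x) 0; last by exists x; rewrite // !inE eqxx.
have [py|py _] := eqVneq (psi y) 0; last by exists y; rewrite // !inE eqxx ?orbT.
by rewrite px py !mulr0 subrr eqxx.
Qed.

(** Over F_2 a coordinate summing to 0 over the triple cannot be nonzero three times; where it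
    vanishes, the other one does not. *)
Lemma triple_axis : p = 2%N ->
  (exists2 g, g \in [set x; y; z] & (phi g != 0) && (psi g == 0)) /\
  (exists2 g, g \in [set x; y; z] & (psi g != 0) && (phi g == 0)).
Proof.
move=> p2; have F2D (a b : 'F_p) : a != 0 -> b != 0 -> - (a + b) = 0.
  by move: a b; rewrite p2 => a b /F2_neq0-> /F2_neq0->; apply: val_inj.
have T0 (f : gT -> 'F_p) : f z = - (f x + f y) ->
  exists2 g, g \in [set x; y; z] & f g == 0.
  move=> fz; have [fx|fx] := eqVneq (f x) 0.
    by exists x; rewrite ?fx // !inE eqxx.
  have [fy|fy] := eqVneq (f y) 0; first by exists y; rewrite ?fy // !inE eqxx ?orbT.
  by exists z; rewrite ?fz ?F2D // !inE eqxx ?orbT.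
split; [have [g Tg g0] := T0 _ psi_triple | have [g Tg g0] := T0 _ phi_triple].
  by exists g => //; have := triple_neq0 Tg; rewrite g0 andbT orbF.
by exists g => //; have := triple_neq0 Tg; rewrite g0 andbT.
Qed.

End Triple.

(** Otherwise [coord_det x v] and [coord_det y v] are nonzero with nonzero sum, hence equal in F_3;
    so [a] and [b] both lie on the line of the difference of [x] and [y]. *)
Lemma F3_triples_meet x y z a b c : p = 3%N ->
    (x * y * z = 1)%g -> <<[set x; y; z]>>%g = [set: gT] ->
    (a * b * c = 1)%g -> <<[set a; b; c]>>%g = [set: gT] ->
  exists u v,
    [/\ u \in [set x; y; z], v \in [set a; b; c] & coord_det u v = 0].
Proof.
move=> p3 xyz1 gen1 abc1 gen2.
have F3D (d e : 'F_p) : d != 0 -> e != 0 -> d + e != 0 -> d = e.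
  by move: d e; rewrite p3; apply: F3_addr_neq0.
case: (pickP [pred uv | [&& uv.1 \in [set x; y; z], uv.2 \in [set a; b; c] &
  coord_det uv.1 uv.2 == 0]]) => [[u v] /and3P[/= Tu Tv /eqP d0] | no].
  by exists u, v.
have nz u v : u \in [set x; y; z] -> v \in [set a; b; c] -> coord_det u v != 0.
  by move=> Tu Tv; have := no (u, v); rewrite /= Tu Tv /= => ->.
have eq_xy v : v \in [set a; b; c] -> coord_det x v = coord_det y v.
  move=> Tv; have nzv u Tu := nz u v Tu Tv.
  apply: F3D; try by apply: nzv; rewrite !inE eqxx ?orbT.
  have := nzv z; rewrite !inE eqxx orbT => /(_ isT).
  apply: contra => /eqP E; rewrite -oppr_eq0 -E /coord_det.
  by rewrite (phi_triple xyz1) (psi_triple xyz1); apply/eqP; ring.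
have := eq_xy a; rewrite !inE eqxx => /(_ isT) Ea.
have := eq_xy b; rewrite !inE eqxx ?orbT => /(_ isT) Eb.
case/eqP: (mulf_neq0 (det_triple xyz1 gen1) (det_triple abc1 gen2)).
(* A Plücker relation, with [coord_det y a * coord_det y b] subtracted and added. *)
have -> : coord_det x y * coord_det a b =
    coord_det y b * (coord_det x a - coord_det y a)
    - coord_det y a * (coord_det x b - coord_det y b).
  by rewrite /coord_det; ring.
by rewrite Ea Eb !subrr !mulr0 subr0.
Qed.

(** * Common powers inside [<[t]>] or [<[s]>] *)

Lemma r_gt0 : (0 < r)%N.
Proof. by case: r r_mod1 => // /eqP; rewrite mod0n modn_small ?prime_gt1. Qed.

Lemma Fp_div_natr (d e : 'F_p) : e != 0 -> exists c : nat, d = e * c%:R.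
Proof.
by move=> e0; exists (d / e : 'F_p); rewrite natr_Zp mulrCA mulfV ?mulr1.
Qed.

(** Both [p ^ n.-1]-th powers generate the subgroup of order [p] of [<[t]>]; the quotient of [psi u]
    by [psi v] gives the exponent matching them. *)
Lemma common_power_t u v : (m <= n)%N ->
    (m < n)%N || (phi u == 0) -> (m < n)%N || (phi v == 0) ->
    psi u != 0 -> psi v != 0 ->
  exists i j, (u ^+ i = v ^+ j /\ u ^+ i != 1)%g.
Proof.
move=> le_mn mu mv u0 v0; have [c uv] := Fp_div_natr (psi u) v0.
exists (p ^ n.-1)%N, (p ^ n.-1 * c)%N.
rewrite (expg_pX_t le_mn mu) expt_p_eq1 -(Fp_nat0 _ p_pr); split=> //.
rewrite [RHS]expgM (expg_pX_t le_mn mv) -expgM -mulnA.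
by apply: expt_pX; rewrite ?prednK // natrM.
Qed.

Lemma expg_pX_s g : (n < m)%N -> odd p || ((r ^ Y g)%N == 1 %[mod 4]) ->
  (g ^+ (p ^ m.-1) = s ^+ (p ^ m.-1 * X g))%g.
Proof.
move=> lt_nm odd_p; rewrite expg_pX ?prednK // -[RHS]mul1g; congr (_ * _)%g.
apply/eqP; rewrite -order_dvdn ot dvdn_mulr // dvdn_exp2l //.
by rewrite -ltnS prednK.
Qed.

Lemma common_power_s u v : (n < m)%N ->
    odd p || ((r ^ Y u)%N == 1 %[mod 4]) ->
    odd p || ((r ^ Y v)%N == 1 %[mod 4]) ->
    phi u != 0 -> phi v != 0 ->
  exists i j, (u ^+ i = v ^+ j /\ u ^+ i != 1)%g.
Proof.
move=> lt_nm ou ov u0 v0; have [c uv] := Fp_div_natr (phi u) v0.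
exists (p ^ m.-1)%N, (p ^ m.-1 * c)%N.
rewrite (expg_pX_s lt_nm ou) exps_p_eq1 -(Fp_nat0 _ p_pr); split=> //.
rewrite [RHS]expgM (expg_pX_s lt_nm ov) -expgM -mulnA.
by apply: exps_pX; rewrite ?prednK // natrM.
Qed.

(** Here [Y g] is even, and the square of the odd number [r] is 1 modulo 4. *)
Lemma r_exp_mod4 g : p = 2%N -> psi g = 0 -> (r ^ Y g)%N = 1 %[mod 4].
Proof.
move=> p2 /eqP; rewrite Fp_nat0 // p2 => /dvdnP[k ->].
have := r_mod1; rewrite p2 mulnC expnM => r1; apply: exp_mod1.
rewrite (divn_eq r 2) r1 -[(1 %% 2)%N]/1%N; have -> : ((r %/ 2 * 2 + 1) ^ 2 =
  (r %/ 2 * (r %/ 2) + r %/ 2) * 4 + 1)%N by ring.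
by rewrite modnMDl.
Qed.

(** * The case [m = n] with [p] odd: a central copy of F_p^2 *)

Section EqualExponents.

Hypotheses (eq_mn : m = n) (odd_p : odd p).

(** With [N = p ^ n.-1], the factors of [r ^ N - 1 = (r - 1) * geom r N] contribute [p] and
    [p ^ n.-1], so [t ^+ N] centralizes [s]. *)
Lemma commute_expt_pX i j : commute (s ^+ i)%g (t ^+ (p ^ n.-1 * j))%g.
Proof.
have r1 : (r ^ (p ^ n.-1))%N = 1 %[mod p ^ n].
  apply/eqP; rewrite eqn_mod_dvd ?expn_gt0 ?r_gt0 // subn1 predn_exp -/(geom _ _).
  rewrite -{1}(prednK n_gt0) expnS dvdn_mul //; last exact: dvdn_geom r_mod1.
  by rewrite -subn1 -eqn_mod_dvd ?r_gt0 //; apply/eqP/r_mod1.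
rewrite /commute conjgC conj_sX; congr (_ * _)%g; apply/eqP.
by rewrite eq_expg_s eq_mn -modnMmr expnM (exp_mod1 j r1) modnMmr muln1.
Qed.

Lemma commute_exps_pX i j : commute (s ^+ (p ^ n.-1 * j))%g (t ^+ i)%g.
Proof.
rewrite /commute conjgC conj_sX -mulnA; congr (_ * _)%g; apply: exps_pX.
  by rewrite eq_mn prednK.
rewrite natrM natrX; have /eqP -> : (r%:R == 1%:R :> 'F_p)%R.
  by rewrite Fp_natE // r_mod1.
by rewrite expr1n mulr1.
Qed.

Lemma expg_socle g l : (g ^+ (p ^ n.-1 * l) =
  t ^+ (p ^ n.-1 * (Y g * l)) * s ^+ (p ^ n.-1 * (X g * l)))%g.
Proof.
rewrite expgM expg_pX ?odd_p // ?eq_mn ?prednK // expgMn.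
  by rewrite -!expgM !mulnA.
by apply: (@commute_sym gT); apply: commute_expt_pX.
Qed.

Lemma socle_central (g h : gT) l : commute (g ^+ (p ^ n.-1 * l))%g h.
Proof.
rewrite expg_socle [h]XY; apply: (@commuteM gT).
  apply: (@commute_sym gT); apply: (@commuteM gT).
    exact: (@commuteX2 gT).
  by apply: (@commute_sym gT); apply: commute_exps_pX.
apply: (@commute_sym gT); apply: (@commuteM gT).
  exact: commute_expt_pX.
exact: (@commuteX2 gT).
Qed.

Lemma socle_inj g h k l : (g ^+ (p ^ n.-1 * k) = h ^+ (p ^ n.-1 * l))%g ->
  phi g * k%:R = phi h * l%:R /\ psi g * k%:R = psi h * l%:R.
Proof.
have cancel a b : p ^ n.-1 * a = p ^ n.-1 * b %[mod p ^ n] -> a%:R = b%:R :> 'F_p.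
  rewrite -{2 4}(prednK n_gt0) expnSr -!muln_modr => /eqP.
  rewrite eqn_pmul2l ?expn_gt0 ?prime_gt0 // => ab.
  by apply/eqP; rewrite Fp_natE.
rewrite expg_socle (expg_socle h) => /coords_uniq[]; rewrite eq_mn.
by move=> /cancel EY /cancel EX; rewrite /phi /psi -!natrM.
Qed.

Lemma expg_socle_eq1 g l : (phi g != 0) || (psi g != 0) ->
  (g ^+ (p ^ n.-1 * l) == 1)%g = (p %| l)%N.
Proof.
move=> g0; apply/idP/idP => [/eqP E | dv].
  have [] := @socle_inj g 1%g l 0; first by rewrite muln0 E.
  rewrite phi1 psi1 !mul0r -Fp_nat0 // => /eqP pl /eqP ql.
  by case/orP: g0 => /negPf g0; move: pl ql; rewrite !mulf_eq0 g0.
rewrite expg_socle -{2}eq_mn.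
have /eqP-> : (t ^+ (p ^ n.-1 * (Y g * l)) == 1)%g.
  by rewrite expt_p_eq1 dvdn_mull.
have /eqP-> : (s ^+ (p ^ m.-1 * (X g * l)) == 1)%g.
  by rewrite exps_p_eq1 dvdn_mull.
by rewrite mulg1.
Qed.

Lemma order_coords g : (phi g != 0) || (psi g != 0) -> #[g]%g = (p ^ n)%N.
Proof.
move=> g0; have : (#[g]%g %| p ^ n)%N.
  by rewrite order_dvdn -{1}(prednK n_gt0) expnSr expg_socle_eq1.
case/(dvdn_pfactor _ _ p_pr) => e le_en og; rewrite og.
move: le_en; rewrite leq_eqVlt => /predU1P[-> //|lt_en].
have le_en : (e <= n.-1)%N by rewrite -ltnS prednK.
have := expg_socle_eq1 1 g0.
by rewrite muln1 -order_dvdn og dvdn_exp2l // Euclid_dvd1.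
Qed.

Lemma coord_det_neq0 g h : coord_det g h != 0 ->
  ((phi g != 0) || (psi g != 0)) && ((phi h != 0) || (psi h != 0)).
Proof.
rewrite /coord_det.
have [->|_] := eqVneq (phi g) 0; have [->|_] := eqVneq (psi g) 0;
have [->|_] := eqVneq (phi h) 0; have [->|_] := eqVneq (psi h) 0;
  by rewrite ?mul0r ?mulr0 ?subrr ?eqxx.
Qed.

Lemma common_power_line u v : coord_det u v = 0 ->
    (phi u != 0) || (psi u != 0) -> (phi v != 0) || (psi v != 0) ->
  exists i j, (u ^+ i = v ^+ j /\ u ^+ i != 1)%g.
Proof.
move=> /subr0_eq d0 u0 v0.
(* The determinant vanishes and [v] has nonzero image, so the image of [u] is a multiple of it; [c]
   is the scalar. *)
have [c [Eph Eps]] : exists c : nat,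
    phi u = phi v * c%:R /\ psi u = psi v * c%:R.
  case/orP: v0 => v0.
    have [c Ec] := Fp_div_natr (phi u) v0; exists c; split=> //.
    by apply: (mulfI v0); rewrite -d0 Ec; ring.
  have [c Ec] := Fp_div_natr (psi u) v0; exists c; split=> //.
  by apply: (mulfI v0); rewrite mulrC d0 Ec; ring.
exists (p ^ n.-1 * 1)%N, (p ^ n.-1 * c)%N; split; last first.
  by rewrite expg_socle_eq1 // Euclid_dvd1.
rewrite expg_socle (expg_socle v) !muln1; congr (_ * _)%g.
  by apply: expt_pX; rewrite ?prednK // natrM.
by apply: exps_pX; rewrite ?eq_mn ?prednK // natrM.
Qed.

(** If the two powers were conjugate of order [p ^ e], their [p ^ e.-1]-th powers would be
    nontrivial and central, hence equal; by [socle_inj] the images of [u] and [v] would then be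
    proportional. *)
Lemma disjoint_powers u v i j : coord_det u v != 0 -> (u ^+ i != 1)%g ->
  (v ^+ j)%g \notin ((u ^+ i) ^: [set: gT])%g.
Proof.
move=> d0 ui1; have /andP[u0 v0] := coord_det_neq0 d0.
apply/imsetP => -[h _ vj].
have pn1 : (p ^ n = p ^ n.-1 * p)%N by rewrite -expnSr prednK.
have [e oe] : exists e, #[u ^+ i]%g = (p ^ e)%N.
  have : (#[u ^+ i]%g %| p ^ n)%N.
    by rewrite order_dvdn -expgM mulnC expgM -(order_coords u0) expg_order expg1n.
  by case/(dvdn_pfactor _ _ p_pr) => e _ oe; exists e.
have e_gt0 : (0 < e)%N.
  by case: e oe => // /eqP; rewrite expn0 order_eq1 (negPf ui1).
(* As [g] has order [p ^ n], this number divides [k * p ^ e]; one factor [p] cancels. *)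
have socle g k : (phi g != 0) || (psi g != 0) -> #[g ^+ k]%g = (p ^ e)%N ->
  exists l, (k * p ^ e.-1 = p ^ n.-1 * l)%N.
  move=> g0 ogk; have : (g ^+ (k * p ^ e) == 1)%g.
    by rewrite expgM -ogk expg_order.
  rewrite -order_dvdn order_coords // pn1 -(prednK e_gt0) expnSr mulnA.
  by rewrite dvdn_pmul2r ?prime_gt0 // => /dvdnP[l ->]; exists l; rewrite mulnC.
have [k uk] := socle u i u0 oe.
have [l vl] : exists l, (j * p ^ e.-1 = p ^ n.-1 * l)%N.
  by apply: (socle v) => //; rewrite vj orderJ.
have ukl : (u ^+ (p ^ n.-1 * k) = v ^+ (p ^ n.-1 * l))%g.
  rewrite -vl [RHS]expgM vj -conjXg -expgM uk.
  by rewrite /conjg socle_central mulKg.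
have [Eph Eps] := socle_inj ukl.
have : (u ^+ (p ^ n.-1 * k) != 1)%g.
  rewrite -uk expgM -order_dvdn oe -{1}(prednK e_gt0) expnSr.
  by rewrite -{2}[(p ^ _)%N]muln1 dvdn_pmul2l ?expn_gt0 ?prime_gt0 // Euclid_dvd1.
rewrite expg_socle_eq1 // -Fp_nat0 //; case/eqP.
apply: (mulfI d0); rewrite mulr0 /coord_det.
have -> : (phi u * psi v - phi v * psi u) * k%:R =
   (phi u * k%:R) * psi v - phi v * (psi u * k%:R) by ring.
by rewrite Eph Eps; ring.
Qed.

End EqualExponents.

(** * Construction of a structure for [p >= 5] *)

Lemma phiV g : phi g^-1%g = - phi g.
Proof. by apply/eqP; rewrite -addr_eq0 -phiM mulVg phi1. Qed.

Lemma psiV g : psi g^-1%g = - psi g.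
Proof. by apply/eqP; rewrite -addr_eq0 -psiM mulVg psi1. Qed.

Lemma gen_st (H : {group gT}) : s \in H -> t \in H -> H = [set: gT] :> {set gT}.
Proof.
move=> Hs Ht; apply/eqP; rewrite eqEsubset subsetT; apply/subsetP => g _.
by rewrite [g]XY groupM ?groupX.
Qed.

(* In the basis (s, t) the two triples have the slopes 0, 1, oo and -1, 1/2, 2,
   which are distinct as soon as p >= 5. *)
Lemma beauville_exists : m = n -> (5 <= p)%N ->
  admits_beauville_structure [set: gT]%G.
Proof.
move=> eq_mn p_ge5.
have odd_p : odd p by case: (even_prime p_pr) p_ge5 => [->|].
exists s, t, (s * t)^-1%g, (t * t * s)%g, (t^-1 * s)%g,
  (t * t * s * (t^-1 * s))^-1%g.
split.
- by rewrite !mulgV.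
- by apply: gen_st; apply: mem_gen; rewrite !inE eqxx ?orbT.
- set H := <<_>>%g.
  have Ha : (t * t * s)%g \in H by apply: mem_gen; rewrite !inE eqxx.
  have Hb : (t^-1 * s)%g \in H by apply: mem_gen; rewrite !inE eqxx ?orbT.
  have Ht : t \in H.
    (* The quotient of the first two elements of the second triple is [t ^+ 3], which generates
       [<[t]>] because [p] is not 3. *)
    have cop : coprime #[t]%g 3.
      rewrite ot coprimeXl // prime_coprime // dvdn_prime2 //.
      by case: eqP p_ge5 => // ->.
    have : (t ^+ 3)%g \in H.
      have -> : (t ^+ 3 = t * t * s * (t^-1 * s)^-1)%g.
        by rewrite invMg invgK !mulgA mulgK expgS expgS expg1 mulgA.
      by rewrite groupM ?groupV.
    have := generator_coprime t 3; rewrite cop => /eqP E.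
    by rewrite -!cycle_subG E.
  have Hs : s \in H by rewrite -(groupMl _ (groupVr Ht)).
  exact: (@gen_st [group of H]).
move=> u v i j Tu Tv ui1; apply: (disjoint_powers eq_mn odd_p) => //.
have [[ps qs] [pt qt]] := (coords_s, coords_t).
have nz1 : (1 != 0 :> 'F_p) by exact: oner_neq0.
have nz2 : (2%:R != 0 :> 'F_p).
  by rewrite Fp_nat0 // dvdn_prime2 //; case: eqP p_ge5 => // ->.
have nzN (d : 'F_p) : d != 0 -> - d != 0 by rewrite oppr_eq0.
(* Each of the nine determinants is 1 or 2 up to sign. *)
move: Tu Tv; rewrite !inE -!orbA => /or3P[] /eqP -> /or3P[] /eqP ->;
  rewrite /coord_det ?(phiV, psiV, phiM, psiM) ps qs pt qt;
  match goal with |- is_true (?d != 0) =>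
    first [have -> : d = 1 by ring | have -> : d = - 1 by ring
         | have -> : d = 2%:R by ring | have -> : d = - 2%:R by ring]
  end; by rewrite ?nzN.
Qed.

(** * Necessary conditions and the signature *)

Section Constraints.

Variables x y z a b c : gT.
Hypothesis bv : beauville_structure [set: gT] x y z a b c.

Lemma no_common_power u v : u \in [set x; y; z] -> v \in [set a; b; c] ->
  ~ exists i j, (u ^+ i = v ^+ j /\ u ^+ i != 1)%g.
Proof.
case: bv => _ _ _ disj Tu Tv [i [j [uv ui1]]].
by have /negP[] := disj u v i j Tu Tv ui1; rewrite -uv class_refl.
Qed.

Lemma beauville_exponents : (5 <= p)%N /\ n = m.
Proof.
have [[xyz abc] gx ga _] := bv.
have odd_p : odd p.
  case: (even_prime p_pr) => // p2.
  have [[u1 Tu1 /andP[pu1 /eqP qu1]] [u2 Tu2 /andP[qu2 pu2]]] :=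
    triple_axis xyz gx p2.
  have [[v1 Tv1 /andP[pv1 /eqP qv1]] [v2 Tv2 /andP[qv2 pv2]]] :=
    triple_axis abc ga p2.
  (* Residues (1, 0) give the condition modulo 4 needed to lift exponents; residues (0, 1) suit
     [common_power_t], which allows [p = 2]. *)
  have [lt_nm|le_mn] := ltnP n m.
    case: (no_common_power Tu1 Tv1).
    by apply: common_power_s; rewrite // r_exp_mod4 ?eqxx ?orbT.
  case: (no_common_power Tu2 Tv2).
  by apply: common_power_t; rewrite // ?pu2 ?pv2 orbT.
have eq_nm : n = m.
  case: (ltngtP n m) => // [lt_nm | lt_mn].
    have [[u Tu pu] [v Tv pv]] := (triple_phi_neq0 xyz gx, triple_phi_neq0 abc ga).
    by case: (no_common_power Tu Tv); apply: common_power_s; rewrite ?odd_p.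
  have [[u Tu pu] [v Tv pv]] := (triple_psi_neq0 xyz gx, triple_psi_neq0 abc ga).
  by case: (no_common_power Tu Tv); apply: common_power_t; rewrite ?lt_mn // ltnW.
split=> //; rewrite leqNgt; apply/negP => p_lt5.
have p3 : p = 3%N by case: p p_pr odd_p p_lt5 => [|[|[|[|[|k]]]]].
have [u [v [Tu Tv d0]]] := F3_triples_meet p3 xyz gx abc ga.
case: (no_common_power Tu Tv); apply: common_power_line => //.
  exact: triple_neq0 Tu.
exact: triple_neq0 Tv.
Qed.

Lemma beauville_signature : signature x y z a b c = nseq 6 (p ^ n)%N.
Proof.
have [[xyz abc] gx ga _] := bv.
have [p_ge5 eq_nm] := beauville_exponents.
have odd_p : odd p by case: (even_prime p_pr) p_ge5 => [->|].
have orders x1 y1 z1 :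
    (x1 * y1 * z1 = 1)%g -> <<[set x1; y1; z1]>>%g = [set: gT] ->
    forall g, g \in [set x1; y1; z1] -> #[g]%g = (p ^ n)%N.
  by move=> e1 g1 g Tg; apply: order_coords; rewrite // (triple_neq0 e1 g1).
have [T1 T2] := (orders _ _ _ xyz gx, orders _ _ _ abc ga).
by rewrite /signature (T1 x) ?(T1 y) ?(T1 z) ?(T2 a) ?(T2 b) ?(T2 c) //
  !inE eqxx ?orbT.
Qed.

End Constraints.

End Metacyclic.

(** * The given semidirect product as a metacyclic group *)

Lemma csdprod_presentation (p n m : nat) (p_pr : prime p)
    (n_gt0 : 0 < n) (m_gt0 : 0 < m)
    (lam : {unit 'Z_(p ^ m)}) (lamP : lam ^+ (p ^ n) = 1) :
  exists (s t : csdprod p_pr n_gt0 lamP) (r : nat),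
    [/\ #[s] = (p ^ m)%N, #[t] = (p ^ n)%N, s ^ t = s ^+ r &
        <[s]> ><| <[t]> = [set: csdprod p_pr n_gt0 lamP]].
Proof.
pose to := mul_lam_groupAction p_pr n_gt0 lamP.
have pX_gt1 k : 0 < k -> 1 < p ^ k.
  by move=> k_gt0; rewrite -(expn0 p) ltn_exp2l ?prime_gt1.
(* The exponent [r] represents the inverse of [lam], because [s ^ t] is conjugation from the
   right. *)
exists (sdpair1 to Zp1), (sdpair2 to Zp1), (FinRing.uval (lam ^- 1))%R.
split.
- rewrite order_injm ?injm_sdpair1 ?inE // order_Zp1 Zp_cast //; exact: pX_gt1.
- rewrite order_injm ?injm_sdpair2 ?inE // order_Zp1 Zp_cast //; exact: pX_gt1.
- rewrite -sdpair_act ?inE //.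
  rewrite -morphX ?inE // /= /mul_lam mulr1; congr (sdpair1 _ _).
  by rewrite Zp1_expgz.
rewrite -!morphim_cycle ?inE // -!Zp_cycle; exact: sdprod_sdpair.
Qed.

Theorem theorem4 (p n m : nat) (p_pr : prime p)
    (n_gt0 : (0 < n)%N) (m_gt0 : (0 < m)%N)
    (lam : {unit 'Z_(p ^ m)}) (lamP : lam ^+ (p ^ n) = 1) :
  let G := [set: csdprod p_pr n_gt0 lamP]%G in
  (admits_beauville_structure G <-> (5 <= p)%N /\ n = m) /\
  (forall x y z a b c : csdprod p_pr n_gt0 lamP,
     beauville_structure G x y z a b c ->
     signature x y z a b c = nseq 6 (p ^ n)%N).
Proof.
move=> G; have [s [t [r [os ot st sdG]]]] :=
  csdprod_presentation p_pr n_gt0 m_gt0 lamP.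
have [_ defG nst tist] := sdprodP sdG.
(* Finiteness of the group turns the existence of exponents into coordinate functions. *)
have /fin_all_exists[Y /fin_all_exists[X XY]] :
    forall g, exists j, exists i, g = t ^+ j * s ^+ i.
  move=> g; have : g \in [set: csdprod p_pr n_gt0 lamP] by rewrite inE.
  rewrite -defG -(normC nst) => /mulsgP[_ _ /cycleP[j ->] /cycleP[i ->] ->].
  by exists j, i.
split; last first.
  move=> x y z a b c bv.
  exact: (beauville_signature p_pr n_gt0 m_gt0 os ot st tist XY bv).
split=> [[x [y [z [a [b [c bv]]]]]] | [p_ge5 eq_nm]].
  exact: (beauville_exponents p_pr n_gt0 m_gt0 os ot st tist XY bv).
exact: (beauville_exists p_pr n_gt0 m_gt0 os ot st tist XY (esym eq_nm) p_ge5).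
Qed.
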